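(* Let $X$ be a separable Banach space, $Y$ a Banach space, $G \subset X$ an open set and $f: G \to Y$ a mapping. Then the set of all points $x \in G$ at which $f$ is Lipschitz and Gâteaux differentiable but is not Hadamard differentiable is $\sigma$-directionally porous.
   Context: Banach spaces are real. $B(x,r)$ is the open ball with center $x$ and radius $r$. Let $X,Y$ be Banach spaces, $G\subset X$ open, $f:G\to Y$, $x\in G$. $f$ is Lipschitz at $x$ if $\limsup_{y\to x}\frac{\|f(y)-f(x)\|}{\|y-x\|}<\infty$. $f$ is Gâteaux differentiable at $x$ if there is a continuous linear operator $L:X\to Y$ with $\lim_{t\to 0}\frac{f(x+tv)-f(x)}{t}=L(v)$ for each $v\in X$. $f$ is Hadamard differentiable at $x$ if there is a continuous linear operator $L:X\to Y$ such that $\lim_{t\to 0}\frac{f(x+tv)-f(x)}{t}=L(v)$ for each $v\in X$ and, for every compact set $C\subset X$, the limit is uniform with respect to $v\in C$. A set $A\subset X$ is directionally porous at $x\in X$ if there exist $0\ne v\in X$, $p>0$ and a sequence $t_n\to 0$ of positive real numbers such that $B(x+t_nv,pt_n)\cap A=\emptyset$ for each $n$. $A$ is directionally porous if it is directionally porous at each $x\in A$. $A$ is $\sigma$-directionally porous if it is a countable union of directionally porous sets. *)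

(* Defs.v *)
From HB Require Import structures.
From mathcomp Require Import all_boot all_order all_algebra.
From mathcomp Require Import all_classical all_reals all_analysis.
Import Order.TTheory GRing.Theory Num.Theory.
Import numFieldNormedType.Exports.

Set Implicit Arguments.
Unset Strict Implicit.
Unset Printing Implicit Defensive.

Local Open Scope classical_set_scope.
Local Open Scope ring_scope.

Definition separable_space (T : topologicalType) : Prop :=
  exists D : set T, countable D /\ dense D.

(* A mapping defined on an open set G is represented by a total function
   f : X -> Y.  All the pointwise notions below depend only on the germ of f
   at x, so for x in G the values of f outside G are irrelevant. *)

Definition lipschitz_at (R : realType) (X Y : normedModType R)
    (f : X -> Y) (x : X) : Prop :=
  (limf_esup (fun y : X => (`|f y - f x| / `|y - x|)%:E) x^' < +oo)%E.

Definition diff_quotient (R : realType) (X Y : normedModType R)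
    (f : X -> Y) (x : X) (t : R) (v : X) : Y :=
  t^-1 *: (f (x + t *: v) - f x).

Definition gateaux_differentiable (R : realType) (X Y : normedModType R)
    (f : X -> Y) (x : X) : Prop :=
  exists L : {linear X -> Y}, continuous L /\
    forall v : X, diff_quotient f x t v @[t --> 0^'] --> L v.

Definition hadamard_differentiable (R : realType) (X Y : normedModType R)
    (f : X -> Y) (x : X) : Prop :=
  exists L : {linear X -> Y}, [/\ continuous L,
    (forall v : X, diff_quotient f x t v @[t --> 0^'] --> L v) &
    forall C : set X, compact C ->
      {uniform C, diff_quotient f x @ 0^' --> (L : X -> Y)}].

Definition directionally_porous_at (R : realType) (X : normedModType R)
    (A : set X) (x : X) : Prop :=
  exists (v : X) (p : R) (t : nat -> R),
    [/\ v != 0, 0 < p, (forall n, 0 < t n), t n @[n --> \oo] --> 0 &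
        forall n, ball (x + t n *: v) (p * t n) `&` A = set0].

Definition directionally_porous (R : realType) (X : normedModType R)
    (A : set X) : Prop :=
  forall x, A x -> directionally_porous_at A x.

(* The empty set is directionally porous, so unions indexed by nat cover all
   countable unions. *)
Definition sigma_directionally_porous (R : realType) (X : normedModType R)
    (A : set X) : Prop :=
  exists A_ : nat -> set X,
    (forall n, directionally_porous (A_ n)) /\ A = \bigcup_n A_ n.

(* Main.v *)
Require Import Defs.
From HB Require Import structures.
From mathcomp Require Import all_boot all_order all_algebra.
From mathcomp Require Import all_classical all_reals all_analysis.
From mathcomp Require Import ring lra.
Import Order.TTheory GRing.Theory Num.Theory.
Import numFieldNormedType.Exports.

Set Implicit Arguments.
Unset Strict Implicit.
Unset Printing Implicit Defensive.

Local Open Scope classical_set_scope.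
Local Open Scope ring_scope.

(** Split the exceptional set A into countably many pieces A_n, where A_n
    consists of the points of A at which f has the Lipschitz bound with
    constant n + 1 on the ball of radius 1 / (n + 1); [lipschitz_at_within]
    says that the pieces cover A.  Each piece turns out to be directionally
    porous, for the following reason.

    Suppose that A_n is not directionally porous at one of its points x.  Then
    for every direction v and every p > 0 the set A_n meets the ball of center
    x + t v and radius p |t| for all small t
    ([near_not_directionally_porous]).  A point y of A_n in this ball serves as
    a base point for comparing two nearby values of f: for w within p of v,
    both x + t v and x + t w lie within 2 p |t| of y, and the Lipschitz bound
    at y, with a constant K that does not depend on y, gives
    |f (x + t v) - f (x + t w)| <= 3 K p |t|.  Hence the difference quotients
    at x for the directions v and w differ by at most 3 K p, uniformly in
    small t.  So convergence of the difference quotients in the direction v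
    propagates, up to any prescribed error, to a neighborhood of v, and
    compactness turns this local uniformity into uniformity on compact sets:
    f is Hadamard differentiable at x
    ([hadamard_differentiable_not_porous]), contrary to x being in A. *)

Definition lipschitz_within (R : realType) (X Y : normedModType R)
    (f : X -> Y) (K r : R) (x : X) : Prop :=
  forall y, `|y - x| < r -> `|f y - f x| <= K * `|y - x|.

(** Taking the constant and the inverse of the radius to be one and the same
    positive integer leaves a countable family of conditions, each stronger
    than being Lipschitz at x. *)
Lemma lipschitz_at_within (R : realType) (X Y : normedModType R)
    (f : X -> Y) (x : X) :
  lipschitz_at f x ->
  exists n : nat, lipschitz_within f n.+1%:R n.+1%:R^-1 x.
Proof.
move=> /ereal_inf_lt[_ [V Vx <-]] supV.
have [M ubM] : exists M : R, forall y, V y -> `|f y - f x| / `|y - x| <= M.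
  (* The supremum may be -oo, when V is empty; any bound then works. *)
  move: supV; set s := ereal_sup _ => supV.
  have les y : V y -> ((`|f y - f x| / `|y - x|)%:E <= s)%E.
    by move=> Vy; apply: ereal_sup_ubound; exists y.
  case: s supV les => [M| |] // _ les; first by exists M.
  by exists 0 => y /les; rewrite leeNy_eq.
have [r r0 Vr] : exists2 r : R, 0 < r & forall y, `|y - x| < r -> y != x -> V y.
  have /nbhs_ballP[r /= r0 xV] : nbhs x [set y | y != x -> V y] by exact: Vx.
  exists r => // y yr yx; apply: xV => //.
  by rewrite -ball_normE /= distrC.
pose n := maxn (Num.truncn M) (Num.truncn r^-1).
have Mn : M <= n.+1%:R.
  apply: le_trans (ltW (truncnS_gt M)) _.
  by rewrite ler_nat ltnS leq_maxl.
have nr : n.+1%:R^-1 <= r.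
  rewrite -[leRHS]invrK lef_pV2 ?posrE ?invr_gt0 ?ltr0n//.
  apply: le_trans (ltW (truncnS_gt _)) _.
  by rewrite ler_nat ltnS leq_maxr.
exists n => y yn.
have [->|yx] := eqVneq y x; first by rewrite !subrr !normr0 mulr0.
rewrite -ler_pdivrMr ?normr_gt0 ?subr_eq0//.
by apply: le_trans Mn; apply/ubM/Vr => //; exact: lt_le_trans nr.
Qed.

(** Non-porosity in the two directions v and - v takes care of t > 0 and of
    t < 0.  Porosity excludes the zero direction, but for v = 0 the point x
    itself lies in the ball. *)
Lemma near_not_directionally_porous (R : realType) (X : normedModType R)
    (A : set X) (x : X) :
  A x -> ~ directionally_porous_at A x ->
  forall (v : X) (p : R), 0 < p ->
    \forall t \near 0^', exists2 y, A y & `|x + t *: v - y| < p * `|t|.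
Proof.
move=> Ax nporous v p p0.
have [->|v0] := eqVneq v 0.
  near=> t; exists x => //; rewrite scaler0 addr0 subrr normr0 mulr_gt0//.
  by rewrite normr_gt0; near: t; exact: nbhs_dnbhs_neq.
(* If A missed such balls for arbitrarily small t > 0, choosing t below
   1 / (n + 1) for each n would witness porosity in the direction u. *)
have hit u : u != 0 -> exists2 d : R, 0 < d & forall t, 0 < t < d ->
    exists2 y, A y & `|x + t *: u - y| < p * t.
  move=> u0; apply: contrapT => miss; apply: nporous.
  have /choice[t tP] : forall n : nat, exists t : R, 0 < t < n.+1%:R^-1 /\
      ball (x + t *: u) (p * t) `&` A = set0.
    move=> n; apply: contrapT => nt; apply: miss.
    exists n.+1%:R^-1; first by rewrite invr_gt0.
    move=> t tn; apply: contrapT => ny; apply: nt; exists t; split=> //.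
    apply/seteqP; split=> // y [xy Ay]; apply: ny; exists y => //.
    by move: xy; rewrite -ball_normE.
  exists u, p, t; split=> //.
  - by move=> n; have [/andP[]] := tP n.
  - apply: (squeeze_cvgr _ (cvg_cst 0) cvg_harmonic).
    apply: nearW => n; have [/andP[t0 tn] _] := tP n.
    by rewrite (ltW t0) /= (ltW tn).
  - by move=> n; have [] := tP n.
have [d1 d10 hitv] := hit v v0.
have [d2 d20 hitNv] : exists2 d : R, 0 < d & forall t, 0 < t < d ->
    exists2 y, A y & `|x + t *: (- v) - y| < p * t.
  by apply: hit; rewrite oppr_eq0.
near=> t.
have t0 : t != 0 by near: t; exact: nbhs_dnbhs_neq.
have td1 : `|t| < d1 by near: t; exact: dnbhs0_lt.
have td2 : `|t| < d2 by near: t; exact: dnbhs0_lt.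
have [tpos|tneg|/eqP] := ltrgt0P t; last by rewrite (negPf t0).
  by apply: hitv; rewrite tpos -[t]gtr0_norm.
rewrite -[t in x + t *: v]opprK scaleNr -scalerN.
by apply: hitNv; rewrite oppr_gt0 tneg -[- t]ltr0_norm.
Unshelve. all: by end_near. Qed.

(** The points of A close to the ray through x in the direction v transfer
    their common Lipschitz bound to pairs of points near that ray; the bound at
    x alone only compares values of f with f x. *)
Lemma hadamard_differentiable_not_porous (R : realType) (X Y : normedModType R)
    (f : X -> Y) (K r : R) (A : set X) (x : X) :
  0 < K -> 0 < r -> A `<=` lipschitz_within f K r ->
  A x -> ~ directionally_porous_at A x ->
  gateaux_differentiable f x -> hadamard_differentiable f x.
Proof.
move=> K0 r0 lipA Ax nporous [L [ctsL dL]]; exists L; split=> // C cptC.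
move=> P /uniform_nbhs[E [entE EP]].
have [e /= e0 eE] : exists2 e : R, 0 < e &
    forall a b : Y, `|a - b| < e -> E (a, b).
  move: entE; rewrite -entourage_ballE => -[e e0 eE]; exists e => // a b ab.
  by apply: eE; rewrite /= -ball_normE.
have e3 : 0 < e / 3 by rewrite divr_gt0.
(* With this p the Lipschitz bounds at y add up to K (p + 2 p) |t|, which is
   |t| e / 3; the other two thirds of e pay for the convergence in the
   direction v and for the continuity of L at v. *)
pose p := e / (9 * K).
have p0 : 0 < p by rewrite divr_gt0 ?mulr_gt0.
have Kp : K * (3 * p) = e / 3 by rewrite /p; field; rewrite gt_eqF.
(* Stated for one t and one direction at a time, so that compactness of C, in
   its near-covering form, reduces it to directions near a fixed v. *)
suff unif : \forall t \near 0^',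
    C `<=` (fun w => `|L w - diff_quotient f x t w| < e).
  rewrite /= /nbhs/=; apply: filterS unif => t Ct; apply: EP => w Cw.
  exact/eE/Ct.
move: cptC => /compact_near_coveringP; apply=> v Cv.
have nearv : \forall w \near v, `|v - w| < p /\ `|L v - L w| < e / 3.
  apply: filterI.
    by have := nbhsx_ballx v p p0; rewrite -ball_normE.
  by have /cvgrPdist_lt/(_ _ e3) := ctsL v.
have neart : \forall t \near 0^', [/\ t != 0 , `|t| < r / (2 * p),
    `|L v - diff_quotient f x t v| < e / 3 &
    exists2 y, A y & `|x + t *: v - y| < p * `|t|].
  near=> t; split; near: t.
  - exact: nbhs_dnbhs_neq.
  - by apply: dnbhs0_lt; rewrite divr_gt0// mulr_gt0.
  - by have /cvgrPdist_lt/(_ _ e3) := dL v.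
  - exact: near_not_directionally_porous.
near=> w t.
have [vw Lvw] : `|v - w| < p /\ `|L v - L w| < e / 3 by near: w.
have [t0 tr dv [y Ay xvy]] : [/\ t != 0, `|t| < r / (2 * p),
    `|L v - diff_quotient f x t v| < e / 3 &
    exists2 y, A y & `|x + t *: v - y| < p * `|t|] by near: t.
have tgt0 : 0 < `|t| by rewrite normr_gt0.
have pt0 : 0 < p * `|t| by rewrite mulr_gt0.
have xwy : `|x + t *: w - y| < 2 * p * `|t|.
  have -> : x + t *: w - y = (x + t *: v - y) - t *: (v - w).
    by rewrite scalerBr opprB addrAC [RHS]addrC (addrAC x (t *: v))
      (addrC (x - y) (t *: v)) subrKA addrC.
  apply: le_lt_trans (ler_normB _ _) _; rewrite normrZ.
  have : `|t| * `|v - w| < `|t| * p by rewrite ltr_pM2l.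
  lra.
have tpr : 2 * p * `|t| < r by rewrite mulrC -ltr_pdivlMr// mulr_gt0.
have fwv : `|f (x + t *: v) - f (x + t *: w)| <= e / 3 * `|t|.
  have lipv : `|f (x + t *: v) - f y| <= K * (p * `|t|).
    apply: le_trans (lipA _ Ay _ _) _; last by rewrite ler_pM2l// ltW.
    by apply: lt_trans tpr; lra.
  have lipw : `|f (x + t *: w) - f y| <= K * (2 * p * `|t|).
    apply: le_trans (lipA _ Ay _ _) _; last by rewrite ler_pM2l// ltW.
    exact: lt_trans tpr.
  rewrite -Kp; apply: le_trans (ler_distD (f y) _ _) _.
  rewrite [X in _ + X]distrC; lra.
have dvw : `|diff_quotient f x t v - diff_quotient f x t w| <= e / 3.
  rewrite /diff_quotient -scalerBr normrZ normfV.
  rewrite ler_pdivrMl// mulrC; apply: le_trans fwv.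
  by rewrite opprB subrKA.
have := ler_distD (L v) (L w) (diff_quotient f x t w).
have := ler_distD (diff_quotient f x t v) (L v) (diff_quotient f x t w).
rewrite [`|L w - L v|]distrC; lra.
Unshelve. all: by end_near. Qed.

Theorem theorem3p4 (R : realType) (X Y : completeNormedModType R)
    (sepX : separable_space X) (G : set X) (openG : open G) (f : X -> Y) :
  sigma_directionally_porous
    [set x : X | [/\ G x, lipschitz_at f x, gateaux_differentiable f x &
                     ~ hadamard_differentiable f x]].
Proof.
set A := [set x | _].
pose A_ n := A `&` lipschitz_within f n.+1%:R n.+1%:R^-1.
exists A_; split=> [n x Anx|].
  have [[_ _ gdf nhdf] _] := Anx.
  apply: contrapT => nporous; apply: nhdf.
  apply: (@hadamard_differentiable_not_porous _ _ _ f n.+1%:R n.+1%:R^-1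
    (A_ n)) => //.
  by move=> y [].
apply/seteqP; split=> [x Ax|x [n _ []]//].
by have [_ /lipschitz_at_within[n]] := Ax; exists n.
Qed.
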